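(* Let $G$ be a baseline cdf with pdf $g$ and let $a,b,m,n>0$. Then, as $t\to\infty$, the pdf $f$, the cdf $F$ and the hazard rate function $h$ of the $BKw\text{-}G$ distribution with parameters $a,b,m,n$ satisfy $$f(t;a,b,m,n)\sim\frac{ab\,g(t)[1-G(t)^a]^{bn-1}}{B(m,n)},$$ $$1-F(t;a,b,m,n)\sim\frac{[1-G(t)^a]^{bn}}{n\,B(m,n)},$$ $$h(t;a,b,m,n)\sim ab\,n\,g(t)[1-G(t)^a]^{-1}.$$
   Context: $G$ is the (differentiable) cdf of an absolutely continuous distribution on $(0,\infty)$, with pdf $g(t)=\frac{d}{dt}G(t)$, and $G(t)<1$ for all finite $t$. $u(t)\sim v(t)$ means $u(t)=v(t)(1+o(1))$. $B(m,n)$ is the beta function and $I_x(m,n)=B(m,n)^{-1}\int_0^x v^{m-1}(1-v)^{n-1}\,dv$. The Beta Kumaraswamy-$G$ ($BKw\text{-}G$) distribution with parameters $a,b,m,n>0$ has cdf $F(t;a,b,m,n)=I_{1-[1-G(t)^a]^b}(m,n)$, pdf $$f(t;a,b,m,n)=\frac{ab\,g(t)G(t)^{a-1}[1-G(t)^a]^{bn-1}\left[1-[1-G(t)^a]^b\right]^{m-1}}{B(m,n)},$$ and hazard rate function $h(t;a,b,m,n)=f(t;a,b,m,n)/\left(1-F(t;a,b,m,n)\right)$. *)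

(* Defs.v *)
From HB Require Import structures.
From mathcomp Require Import all_boot all_order all_algebra.
From mathcomp Require Import all_classical all_reals all_analysis.

Set Implicit Arguments.
Unset Strict Implicit.
Unset Printing Implicit Defensive.

Import Order.TTheory GRing.Theory Num.Theory.
Import numFieldNormedType.Exports.

Local Open Scope classical_set_scope.
Local Open Scope ring_scope.

(* u(t) = v(t) (1 + o(1)) as t -> +oo.  The equation is required only for large
   t, and v may vanish. *)
Definition asymp_equiv (R : realType) (u v : R -> R) : Prop :=
  exists2 e : R -> R, e t @[t --> +oo] --> 0 &
    \forall t \near +oo, u t = v t * (1 + e t).

(* With `^ = powR, 0 `^ p = 0 for p < 0: the integrand is finite at 0 and 1,
   where its value does not matter. *)
Definition beta_integrand (R : realType) (m n v : R) : R :=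
  v `^ (m - 1) * (1 - v) `^ (n - 1).

(* The beta_fun of MathComp-Analysis only takes nat parameters. *)
Definition Beta (R : realType) (m n : R) : R :=
  \int[lebesgue_measure]_(v in `[0, 1]) beta_integrand m n v.

Definition Ibeta (R : realType) (x m n : R) : R :=
  (Beta m n)^-1 * \int[lebesgue_measure]_(v in `[0, x]) beta_integrand m n v.

Section BKwG.
Variables (R : realType) (G g : R -> R) (a b m n : R).

Definition BKwG_cdf (t : R) : R :=
  Ibeta (1 - (1 - G t `^ a) `^ b) m n.

Definition BKwG_pdf (t : R) : R :=
  a * b * g t * G t `^ (a - 1) * (1 - G t `^ a) `^ (b * n - 1) *
  (1 - (1 - G t `^ a) `^ b) `^ (m - 1) / Beta m n.

Definition BKwG_hazard (t : R) : R := BKwG_pdf t / (1 - BKwG_cdf t).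

End BKwG.

(* G and g are the cdf and pdf of X, whose law is absolutely continuous and
   carried by ]0, +oo[; differentiability is only asked on ]0, +oo[, since G
   may have a kink at 0 (e.g. the exponential law). *)
Definition baseline (R : realType) (d : measure_display) (T : measurableType d)
    (P : probability T R) (X : {RV P >-> R}) (G g : R -> R) : Prop :=
  [/\ distribution P X `]0, +oo[ = 1%E,
      distribution P X `<< lebesgue_measure,
      forall t : R, cdf X t = (G t)%:E,
      forall t : R, 0 < t -> is_derive t 1 G (g t) &
      forall t : R, G t < 1].

(* Main.v *)
Require Import Defs.
From HB Require Import structures.
From mathcomp Require Import all_boot all_order all_algebra.
From mathcomp Require Import all_classical all_reals all_analysis.
From mathcomp Require Import measurable_realfun.
From mathcomp Require Import ring lra.

Import Order.TTheory GRing.Theory Num.Theory.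
Import numFieldNormedType.Exports.

Local Open Scope classical_set_scope.
Local Open Scope ring_scope.

(** Put w = 1 - G^a and y = w^b.  As G tends to 1 from below, w and y tend to 0
    from above, so the factors G^(a-1) and (1 - y)^(m-1) of the density tend
    to 1; dropping them gives the first equivalence.

    Since the integral of the Beta density over [0, 1] is 1,
    1 - F = 1 - I_(1-y)(m, n) is B(m, n)^-1 times the integral J(y) of
    v^(m-1) (1-v)^(n-1) over [1 - y, 1] ([Beta_tailE]).  On that interval
    v^(m-1) is within |(1-y)^(m-1) - 1| of 1, by monotonicity, while
    (1-v)^(n-1) integrates exactly to y^n / n.  Hence J(y) is y^n / n up to a
    relative error |(1-y)^(m-1) - 1|, which tends to 0 ([beta_tail],
    [beta_tail_equiv]); as y^n = w^(bn), this is the second equivalence.  The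
    third one is the quotient of the first two.

    The analytic point is that the powers may be unbounded at the ends of the
    interval (when m < 1 or n < 1).  Their integrals are computed by a
    fundamental theorem of calculus for nonnegative functions that are
    continuous on the open interval only ([ge0_FTC2_oo]), and the same values
    give the integrability of the Beta density, without which the total
    integral B(m, n) could not be split at 1 - y. *)

(** * Integrals of powers that are unbounded at an endpoint *)

(** The ordinary fundamental theorem applies on [a + eps, b - eps]; as eps
    decreases to 0, monotone convergence handles the integral and the one-sided
    continuity of F at a and b handles the right-hand side.  Nonnegativity of f
    replaces any integrability assumption. *)
Lemma ge0_FTC2_oo (R : realType) (f F : R -> R) (a b : R) : a < b ->
  {in `]a, b[, forall x, 0 <= f x} ->
  {in `]a, b[, continuous f} ->
  derivable_oo_LRcontinuous F a b ->
  {in `]a, b[, derive1 F =1 f} ->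
  (\int[lebesgue_measure]_(x in `[a, b]) (f x)%:E = (F b - F a)%:E)%E.
Proof.
move=> ab f0 cf [dF Fa Fb] F'f.
(* The shift to k + 3 keeps a + eps k < b - eps k for every k, including 0. *)
pose eps k : R := (b - a) / k.+3%:R.
have eps_gt0 k : 0 < eps k by rewrite divr_gt0// subr_gt0.
have eps_lt k : eps k + eps k < b - a.
  rewrite -mulrDl ltr_pdivrMr// -mulr2n -[ltLHS]mulr_natr ltr_pM2l ?subr_gt0//.
  by rewrite ltr_nat.
have eps_cvg0 : eps k @[k --> \oo] --> 0.
  rewrite -(mulr0 (b - a)); apply: cvgMr.
  have := @cvg_harmonic R; rewrite -(cvg_shiftn 2)/=.
  by apply: cvg_trans; apply: near_eq_cvg; near=> k; rewrite addn2.
pose I k := `[a + eps k, b - eps k]%classic.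
have I_sub k : I k `<=` `]a, b[.
  move=> x; rewrite /I /= !in_itv/= => /andP[ax xb].
  by have := eps_gt0 k => ?; apply/andP; split; lra.
have I_homo : {homo I : i j / (i <= j)%N >-> (i <= j)%O}.
  move=> i j ij; apply/subsetPset => x; rewrite /I /= !in_itv/= => /andP[ax xb].
  have : eps j <= eps i.
    by rewrite ler_pM2l ?subr_gt0// lef_pV2 ?posrE// ler_nat !ltnS.
  by move=> ?; apply/andP; split; lra.
have I_cup : \bigcup_k I k = `]a, b[%classic.
  apply/seteqP; split => [x [k _]|x]; first exact: I_sub.
  rewrite /= in_itv/= => /andP[ax xb].
  have : \forall k \near \oo, eps k < Num.min (x - a) (b - x).
    by apply: (cvgr_lt _ eps_cvg0); rewrite lt_min !subr_gt0 ax xb.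
  case=> k _ /(_ k (leqnn _)); rewrite /= lt_min => /andP[h1 h2].
  by exists k => //; rewrite /I /= in_itv/=; apply/andP; split; lra.
have mf : measurable_fun `]a, b[ f.
  apply: open_continuous_measurable_fun => // x; rewrite inE; exact: cf.
rewrite -integral_itv_bndo_bndc; last first.
  apply/measurable_EFinP.
  by apply/measurable_fun_itv_obnd_cbndP.
rewrite -integral_itv_obnd_cbnd; last exact/measurable_EFinP.
have cvgI : (\int[lebesgue_measure]_(x in I i) (f x)%:E)%E @[i --> \oo] -->
    (\int[lebesgue_measure]_(x in `]a, b[) (f x)%:E)%E.
  rewrite -I_cup; apply: ge0_nondecreasing_set_cvg_integral => //.
  - by move=> i; exact: measurable_itv.
  - by move=> i; apply/measurable_EFinP; apply: measurable_funS (I_sub i) mf.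
  - by move=> i x /I_sub/= xab; rewrite lee_fin f0.
apply/esym/(cvg_unique _ _ cvgI) => //.
have cF x : x \in `]a, b[ -> {for x, continuous F}.
  by move=> xab; apply/differentiable_continuous/derivable1_diffP/dF.
have -> : (fun i => \int[lebesgue_measure]_(x in I i) (f x)%:E)%E =
    (fun i => (F (b - eps i) - F (a + eps i))%:E).
  apply/funext => i; have ui : a + eps i < b - eps i by have := eps_lt i; lra.
  have uI : a + eps i \in `]a, b[.
    by have [? ?] := (eps_gt0 i, eps_lt i); rewrite in_itv/=; apply/andP; split; lra.
  have wI : b - eps i \in `]a, b[.
    by have [? ?] := (eps_gt0 i, eps_lt i); rewrite in_itv/=; apply/andP; split; lra.
  rewrite EFinB; apply: continuous_FTC2 => //.
  - apply: continuous_in_subspaceT => x; rewrite inE => /I_sub; exact: cf.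
  - split.
    + by move=> x /subset_itv_oo_cc xI; apply: dF; exact: (I_sub i x xI).
    + by apply: cvg_at_right_filter; exact: cF.
    + by apply: cvg_at_left_filter; exact: cF.
  - by move=> x /subset_itv_oo_cc xI; apply: F'f; exact: (I_sub i x xI).
apply: cvg_EFin; first exact: nearW.
apply: cvgB.
- move/cvg_at_leftP : Fb => /(_ (fun k => b - eps k)); apply; split.
    by move=> k; rewrite gtrBl.
  by rewrite -[X in _ --> X](subr0 b); apply: cvgB => //; exact: cvg_cst.
- move/cvg_at_rightP : Fa => /(_ (fun k => a + eps k)); apply; split.
    by move=> k; rewrite ltrDl.
  by rewrite -[X in _ --> X](addr0 a); apply: cvgD => //; exact: cvg_cst.
Unshelve. all: end_near. Qed.

Lemma powR_continuous (R : realType) (p x : R) : 0 < x ->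
  {for x, continuous (fun v : R => v `^ p)}.
Proof.
move=> x0; apply/differentiable_continuous/derivable1_diffP.
by apply: derivable_powR; rewrite in_itv/= x0.
Qed.

(** Real powers are only continuous at 0 from the right (a negative number to
    any power is 1), hence the need for one-sided convergence below. *)
Lemma cvg_to_at_right (R : realType) (T : Type) (F : set_system T) (u : T -> R)
    (l : R) : Filter F ->
  u t @[t --> F] --> l -> (\forall t \near F, l < u t) -> u t @[t --> F] --> l^'+.
Proof.
move=> FF ul lu A Al; have {}Al := ul _ Al.
by apply: filterS2 lu Al => t lut; apply.
Qed.

Lemma cvg_powR0 (R : realType) (T : Type) (F : set_system T) (u : T -> R)
    (p : R) : Filter F -> 0 < p ->
  u t @[t --> F] --> (0 : R) -> (\forall t \near F, 0 < u t) ->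
  u t `^ p @[t --> F] --> (0 : R).
Proof.
move=> FF p0 ul lu.
exact: (cvg_comp _ _ (cvg_to_at_right _ _ _ _ _ _ ul lu) (powR_cvg0 p0)).
Qed.

Lemma cvg_powR1 (R : realType) (T : Type) (F : set_system T) (u : T -> R)
    (p : R) : Filter F ->
  u t @[t --> F] --> (1 : R) -> u t `^ p @[t --> F] --> (1 : R).
Proof.
move=> FF u1; rewrite -[X in _ --> X](_ : 1 `^ p = 1 :> R); last by rewrite powR1.
exact: (cvg_comp _ _ u1 (powR_continuous R p 1 ltr01)).
Qed.

Lemma integral_powR (R : realType) (p c : R) : 0 < p -> 0 < c ->
  (\int[lebesgue_measure]_(v in `[0%R, c]) (v `^ (p - 1))%R%:E =
   (c `^ p / p)%R%:E)%E.
Proof.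
move=> p0 c0; have dF (x : R) : 0 < x ->
    is_derive x (1 : R) (fun v => v `^ p / p) (x `^ (p - 1)).
  move=> x0; have := is_derive1_powR p x0 => dp.
  apply: is_derive_eq; rewrite /GRing.scale/=.
  by field; rewrite gt_eqF.
rewrite (ge0_FTC2_oo _ _ (fun v => v `^ p / p))//.
- by rewrite powR0 ?gt_eqF// mul0r subr0.
- by move=> x _; rewrite powR_ge0.
- by move=> x; rewrite in_itv/= => /andP[x0 _]; exact: powR_continuous.
- split => [x||].
  + by rewrite in_itv/= => /andP[x0 _]; have [] := dF x x0.
  + rewrite powR0 ?gt_eqF//; apply: cvgMl; exact: powR_cvg0.
  + by apply: cvgMl; apply: cvg_at_left_filter; exact: powR_continuous.
- move=> x; rewrite in_itv/= => /andP[x0 _].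
  by rewrite derive1E; have [] := dF x x0.
Qed.

Lemma integral_onem_powR (R : realType) (p c : R) : 0 < p -> c < 1 ->
  (\int[lebesgue_measure]_(v in `[c, 1%R]) ((1 - v) `^ (p - 1))%R%:E =
   ((1 - c) `^ p / p)%R%:E)%E.
Proof.
move=> p0 c1; have dF (x : R) : x < 1 ->
    is_derive x (1 : R) (fun v => - ((1 - v) `^ p / p)) ((1 - x) `^ (p - 1)).
  move=> x1; have x0 : 0 < 1 - x by rewrite subr_gt0.
  have := is_derive1_powR p x0 => dp.
  have dg : is_derive x (1 : R) (fun v : R => 1 - v) (- 1).
    by apply: is_derive_eq; rewrite add0r mul1r.
  have dpg := @is_derive1_comp R (fun v => v `^ p) (fun v => 1 - v) x _ _ dp dg.
  apply: is_derive_eq; rewrite /GRing.scale/=.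
  by field; rewrite gt_eqF.
rewrite (ge0_FTC2_oo _ _ (fun v => - ((1 - v) `^ p / p)))//.
- by rewrite subrr powR0 ?gt_eqF// mul0r oppr0 sub0r opprK.
- by move=> x _; rewrite powR_ge0.
- move=> x; rewrite in_itv/= => /andP[_ x1].
  apply: (@continuous_comp _ _ _ (fun v : R => 1 - v) (fun v => v `^ (p - 1))).
    by apply: cvgB; [exact: cvg_cst|exact: cvg_id].
  by apply: powR_continuous; rewrite subr_gt0.
- split => [x||].
  + by rewrite in_itv/= => /andP[_ x1]; have [] := dF x x1.
  + have cF : {for c, continuous (fun v : R => - ((1 - v) `^ p / p))}.
      by apply/differentiable_continuous/derivable1_diffP; have [] := dF c c1.
    exact: cvg_at_right_filter cF.
  + apply: cvgN; apply: cvgMl; rewrite subrr powR0 ?gt_eqF//.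
    apply: cvg_powR0 => //.
    * rewrite -[X in _ --> X](subrr 1); apply: cvgB; first exact: cvg_cst.
      by apply: cvg_at_left_filter; exact: cvg_id.
    * by near=> t; rewrite subr_gt0.
- move=> x; rewrite in_itv/= => /andP[_ x1].
  by rewrite derive1E; have [] := dF x x1.
Unshelve. all: end_near. Qed.

(** * The Beta integrand and its upper tail *)

(** On ]0, 1] the function v |-> v^p is monotone with value 1 at 1, whatever the
    sign of p, so its distance to 1 on [c, 1] is largest at c. *)
Lemma powR_dist1 (R : realType) (p c v : R) : 0 < c -> c <= v <= 1 ->
  `|v `^ p - 1| <= `|c `^ p - 1|.
Proof.
move=> c0 /andP[cv v1].
have v0 : 0 < v by exact: lt_le_trans cv.
have cn : c \is Num.nneg by rewrite nnegrE ltW.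
have vn : v \is Num.nneg by rewrite nnegrE ltW.
have onep q : 1 `^ q = 1 :> R by rewrite powR1.
have [p0|p0] := leP 0 p.
  have cvp : c `^ p <= v `^ p by apply: ge0_ler_powR.
  have vp1 : v `^ p <= 1.
    by rewrite -[leRHS](onep p); apply: ge0_ler_powR => //; rewrite nnegrE.
  by rewrite !ler0_norm ?subr_le0//; lra.
have Np0 : 0 <= - p by rewrite oppr_ge0 ltW.
have cvp : v `^ p <= c `^ p.
  rewrite -[p]opprK !(powRN _ (- p)) lef_pV2 ?posrE ?powR_gt0//.
  exact: ge0_ler_powR.
have vp1 : 1 <= v `^ p.
  rewrite -[p]opprK (powRN _ (- p)) invf_ge1 ?powR_gt0//.
  by rewrite -[leRHS](onep (- p)); apply: ge0_ler_powR => //; rewrite nnegrE.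
by rewrite !ger0_norm ?subr_ge0//; lra.
Qed.

Lemma beta_integrand_ge0 (R : realType) (m n v : R) : 0 <= beta_integrand m n v.
Proof. by rewrite mulr_ge0// powR_ge0. Qed.

Lemma measurable_onem_powR (R : realType) (p : R) (D : set R) :
  measurable_fun D (fun v : R => (1 - v) `^ p).
Proof.
apply: (measurableT_comp (measurable_powR p)).
by apply: measurable_funB => //; exact: measurable_cst.
Qed.

Lemma measurable_beta_integrand (R : realType) (m n : R) (D : set R) :
  measurable_fun D (beta_integrand m n).
Proof.
apply: measurable_funM; last exact: measurable_onem_powR.
exact: measurable_funTS (measurable_powR _).
Qed.

Lemma integrable_powR (R : realType) (p c : R) : 0 < p -> 0 < c ->
  lebesgue_measure.-integrable `[0, c] (EFin \o (fun v : R => v `^ (p - 1))).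
Proof.
move=> p0 c0; apply/integrableP; split.
  by apply/measurable_EFinP; exact: measurable_funTS (measurable_powR _).
under eq_integral do rewrite /= ger0_norm ?powR_ge0//.
by rewrite integral_powR// ltry.
Qed.

Lemma integrable_onem_powR (R : realType) (p c : R) : 0 < p -> c < 1 ->
  lebesgue_measure.-integrable `[c, 1]
    (EFin \o (fun v : R => (1 - v) `^ (p - 1))).
Proof.
move=> p0 c1; apply/integrableP; split.
  by apply/measurable_EFinP; exact: measurable_onem_powR.
under eq_integral do rewrite /= ger0_norm ?powR_ge0//.
by rewrite integral_onem_powR// ltry.
Qed.

(** Each factor of the integrand is bounded on the half of [0, 1] away from its
    singularity, so a combination of the two pure powers dominates it. *)
Lemma integrable_beta_integrand (R : realType) (m n : R) : 0 < m -> 0 < n ->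
  lebesgue_measure.-integrable `[0, 1] (EFin \o beta_integrand m n).
Proof.
move=> m0 n0.
pose K p : R := `|2^-1 `^ (p - 1) - 1|.
have powR_le p v : 2^-1 <= v <= 1 -> v `^ (p - 1) <= 1 + K p.
  move=> v1; rewrite -lerBlDl; apply: le_trans (ler_norm _) _.
  exact: powR_dist1.
have K0 p : 0 <= 1 + K p by rewrite addr_ge0// normr_ge0.
have dom_int : lebesgue_measure.-integrable `[0, 1] (fun v : R =>
    ((1 + K n)%:E * (v `^ (m - 1))%R%:E +
     (1 + K m)%:E * ((1 - v) `^ (n - 1))%R%:E)%E).
  apply: integrableD => //; apply: integrableZl => //.
    exact: integrable_powR ltr01.
  exact: integrable_onem_powR.
apply: le_integrable dom_int => //.
  by apply/measurable_EFinP; exact: measurable_beta_integrand.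
move=> v; rewrite /= in_itv/= => /andP[v0 v1].
rewrite lee_fin ger0_norm ?beta_integrand_ge0//.
rewrite ger0_norm ?addr_ge0 ?mulr_ge0 ?powR_ge0// /beta_integrand.
have [v2|v2] := leP v 2^-1.
  rewrite ler_wpDr ?mulr_ge0 ?powR_ge0// mulrC ler_wpM2r ?powR_ge0//.
  by apply: powR_le; apply/andP; split; lra.
rewrite ler_wpDl ?mulr_ge0 ?powR_ge0// ler_wpM2r ?powR_ge0//.
by apply: powR_le; apply/andP; split; lra.
Qed.

(** Replacing v^(m-1) by 1 on [1 - y, 1] costs at most a factor 1 +- K with
    K = |(1-y)^(m-1) - 1|, and what remains has the primitive - (1-v)^n / n. *)
Lemma beta_tail (R : realType) (m n y : R) : 0 < m -> 0 < n -> 0 < y < 1 ->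
  `|\int[lebesgue_measure]_(v in `[1 - y, 1]) beta_integrand m n v - y `^ n / n|
  <= `|(1 - y) `^ (m - 1) - 1| * (y `^ n / n).
Proof.
move=> m0 n0 /andP[y0 y1].
set K := `|_ `^ _ - 1|.
have c1 : 1 - y < 1 by rewrite gtrBl.
have ib : lebesgue_measure.-integrable `[1 - y, 1] (EFin \o beta_integrand m n).
  apply: integrableS (integrable_beta_integrand _ m n m0 n0) => //.
  by apply: subset_itvr; rewrite bnd_simp subr_ge0 ltW.
have io := integrable_onem_powR R n (1 - y) n0 c1.
have ioZ k : lebesgue_measure.-integrable `[1 - y, 1]
    (EFin \o (fun v => k * (1 - v) `^ (n - 1))).
  by apply: eq_integrable (integrableZl _ k io).
have Io : \int[lebesgue_measure]_(v in `[1 - y, 1]) ((1 - v) `^ (n - 1)) =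
    y `^ n / n.
  by rewrite /Rintegral integral_onem_powR//= subKr.
have near1 v : v \in `[1 - y, 1] -> 1 - K <= v `^ (m - 1) <= 1 + K.
  rewrite in_itv/= => v1; rewrite -ler_distl.
  by apply: powR_dist1 => //; rewrite subr_gt0.
rewrite ler_distl; apply/andP; split.
- rewrite [leLHS](_ : _ = (1 - K) * (y `^ n / n)); last by ring.
  rewrite -Io -RintegralZl//; apply: le_Rintegral => // v /= /near1 /andP[+ _].
  by move=> ?; rewrite ler_wpM2r ?powR_ge0.
- rewrite [leRHS](_ : _ = (1 + K) * (y `^ n / n)); last by ring.
  rewrite -Io -RintegralZl//; apply: le_Rintegral => // v /= /near1 /andP[_ +].
  by move=> ?; rewrite ler_wpM2r ?powR_ge0.
Qed.

Lemma Beta_tailE (R : realType) (m n y : R) : 0 < m -> 0 < n -> 0 < y < 1 ->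
  Beta m n - \int[lebesgue_measure]_(v in `[0, 1 - y]) beta_integrand m n v =
  \int[lebesgue_measure]_(v in `[1 - y, 1]) beta_integrand m n v.
Proof.
move=> m0 n0 /andP[y0 y1].
have ib := integrable_beta_integrand R m n m0 n0.
rewrite Rintegral_itvB ?bnd_simp ?subr_ge0 ?(ltW y1) ?gerBl ?(ltW y0)//.
apply: Rintegral_itv_obnd_cbnd; apply: integrableS ib => //.
by apply: subset_itvr; rewrite bnd_simp subr_ge0 ltW.
Qed.

(** The tail estimate with a relative error below 1 already bounds B(m, n) from
    below by a positive number. *)
Lemma Beta_gt0 (R : realType) (m n : R) : 0 < m -> 0 < n -> 0 < Beta m n.
Proof.
move=> m0 n0.
have [y y01 Ky] : exists2 y : R, 0 < y < 1 & `|(1 - y) `^ (m - 1) - 1| < 1.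
  have : (1 - y) `^ (m - 1) @[y --> (0 : R)^'+] --> (1 : R).
    apply: cvg_powR1; rewrite -[X in _ --> X](subr0 1); apply: cvgB.
      exact: cvg_cst.
    by apply: cvg_at_right_filter; exact: cvg_id.
  move=> /cvgrPdist_lt /(_ 1 ltr01) K1.
  near (0 : R)^'+ => y; exists y.
    by apply/andP; split; near: y; [exact: nbhs_right_gt|exact: nbhs_right_lt].
  by rewrite distrC; near: y.
have := beta_tail R m n y m0 n0 y01; rewrite -Beta_tailE// ler_distl => /andP[+ _].
have y0 : 0 < y `^ n / n by rewrite divr_gt0// powR_gt0; case/andP : y01.
have : 0 <= \int[lebesgue_measure]_(v in `[0, 1 - y]) beta_integrand m n v.
  by apply: Rintegral_ge0 => v _; exact: beta_integrand_ge0.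
nra.
Unshelve. all: end_near. Qed.

(** * Asymptotics at infinity *)

Lemma asymp_equiv_ratio (R : realType) (u v r : R -> R) :
  r t @[t --> +oo] --> (1 : R) -> (\forall t \near +oo, u t = v t * r t) ->
  asymp_equiv u v.
Proof.
move=> r1 uvr; exists (fun t => r t - 1).
  rewrite -[X in _ --> X](subrr (1 : R)).
  by apply: cvgB => //; exact: cvg_cst.
by apply: filterS uvr => t ->; rewrite addrC subrK.
Qed.

Lemma beta_tail_equiv (R : realType) (m n : R) (y : R -> R) : 0 < m -> 0 < n ->
  y t @[t --> +oo] --> (0 : R) -> (\forall t \near +oo, 0 < y t < 1) ->
  (\int[lebesgue_measure]_(v in `[1 - y t, 1]) beta_integrand m n v) /
    (y t `^ n / n) @[t --> +oo] --> (1 : R).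
Proof.
move=> m0 n0 y0 y01.
have bound : (1 - y t) `^ (m - 1) @[t --> +oo] --> (1 : R).
  apply: cvg_powR1; rewrite -[X in _ --> X](subr0 1).
  by apply: cvgB => //; exact: cvg_cst.
apply/cvgrPdist_le => e e0; near=> t.
have yt : 0 < y t < 1 by near: t.
have yn0 : 0 < y t `^ n / n by rewrite divr_gt0// powR_gt0//; case/andP : yt.
rewrite distrC -[X in _ - X](divff (lt0r_neq0 yn0)) -mulrBl normrM.
rewrite [X in _ * X]gtr0_norm ?invr_gt0// ler_pdivrMr//.
apply: le_trans (beta_tail R m n (y t) m0 n0 yt) _.
rewrite ler_wpM2r ?(ltW yn0)// distrC.
by near: t; move/cvgrPdist_le : bound; apply.
Unshelve. all: end_near. Qed.

Lemma baseline_cvg1 (R : realType) (d : measure_display) (T : measurableType d)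
    (P : probability T R) (X : {RV P >-> R}) (G g : R -> R) :
  baseline X G g -> G t @[t --> +oo] --> (1 : R).
Proof.
move=> [_ _ GE _ _].
have /fine_cvgP[_] : (G t)%:E @[t --> +oo] --> 1%:E.
  by rewrite -(funext GE); exact: cvg_cdfy1.
exact.
Qed.

Theorem proposition2 (R : realType) (d : measure_display) (T : measurableType d)
    (P : probability T R) (X : {RV P >-> R}) (G g : R -> R)
    (hG : baseline X G g)
    (a b m n : R) (ha : 0 < a) (hb : 0 < b) (hm : 0 < m) (hn : 0 < n) :
  [/\ asymp_equiv (BKwG_pdf G g a b m n)
        (fun t => a * b * g t * (1 - G t `^ a) `^ (b * n - 1) / Beta m n),
      asymp_equiv (fun t => 1 - BKwG_cdf G a b m n t)
        (fun t => (1 - G t `^ a) `^ (b * n) / (n * Beta m n)) &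
      asymp_equiv (BKwG_hazard G g a b m n)
        (fun t => a * b * n * g t * (1 - G t `^ a)^-1)].
Proof.
have G1 := baseline_cvg1 _ _ _ _ _ _ _ hG.
have G_lt1 : forall t, G t < 1 by case: hG.
have B0 := Beta_gt0 R m n hm hn.
pose w t := 1 - G t `^ a.
pose y t := w t `^ b.
have w01 : \forall t \near +oo, 0 < w t < 1.
  near=> t; have Gt : 0 < G t by near: t; exact: (cvgr_gt _ G1).
  rewrite subr_gt0 gtrBl powR_gt0// andbT.
  rewrite -[ltRHS](_ : 1 `^ a = 1 :> R); last by rewrite powR1.
  by apply: gt0_ltr_powR; rewrite ?nnegrE// ltW.
have w0 : w t @[t --> +oo] --> (0 : R).
  rewrite -[X in _ --> X](subrr (1 : R)); apply: cvgB; first exact: cvg_cst.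
  exact: cvg_powR1.
have y0 : y t @[t --> +oo] --> (0 : R).
  by apply: cvg_powR0 => //; apply: filterS w01 => t /andP[].
have y01 : \forall t \near +oo, 0 < y t < 1.
  near=> t; apply/andP; split; last by near: t; exact: (cvgr_lt _ y0).
  by apply: powR_gt0; have /andP[] : 0 < w t < 1 by near: t.
pose rpdf t := G t `^ (a - 1) * (1 - y t) `^ (m - 1).
have rpdf1 : rpdf t @[t --> +oo] --> (1 : R).
  rewrite -[X in _ --> X](mulr1 (1 : R)); apply: cvgM; apply: cvg_powR1 => //.
  rewrite -[X in _ --> X](subr0 (1 : R)).
  by apply: cvgB => //; exact: cvg_cst.
pose J t := \int[lebesgue_measure]_(v in `[1 - y t, 1]) beta_integrand m n v.
pose rsf t := J t / (y t `^ n / n).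
have rsf1 : rsf t @[t --> +oo] --> (1 : R) by exact: beta_tail_equiv.
have pdfE t : BKwG_pdf G g a b m n t =
    a * b * g t * w t `^ (b * n - 1) / Beta m n * rpdf t.
  rewrite /BKwG_pdf /rpdf -/(w t) -/(y t).
  move: (G t `^ (a - 1)) (w t `^ _) (_ `^ (m - 1)) (Beta m n) => p q s B.
  by ring.
have sfE : \forall t \near +oo, 1 - BKwG_cdf G a b m n t =
    w t `^ (b * n) / (n * Beta m n) * rsf t.
  near=> t; have yt : 0 < y t < 1 by near: t.
  have yn0 : 0 < y t `^ n by rewrite powR_gt0//; case/andP : yt.
  rewrite powRrM -/(y t) /rsf /J -Beta_tailE// /BKwG_cdf /Ibeta -/(w t) -/(y t).
  by field; rewrite !gt_eqF.
split.
- by apply: (asymp_equiv_ratio _ _ _ rpdf rpdf1); apply: nearW => t.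
- exact: (asymp_equiv_ratio _ _ _ rsf rsf1).
- apply: (asymp_equiv_ratio _ _ _ (fun t => rpdf t / rsf t)).
    rewrite -[X in _ --> X](divr1 (1 : R)); apply: cvgM => //.
    by apply: cvgV => //; exact: oner_neq0.
  near=> t; have /andP[wt _] : 0 < w t < 1 by near: t.
  have rt : 0 < rsf t by near: t; exact: (cvgr_gt _ rsf1).
  have wbn : 0 < w t `^ (b * n - 1) by rewrite powR_gt0.
  rewrite /BKwG_hazard pdfE (near sfE t _)// -/(w t).
  (* w^(bn) = w * w^(bn - 1): the density and the tail differ by one power of
     w, which is the factor w^-1 of the hazard rate. *)
  rewrite -(mulr_powRB1 (ltW wt) (mulr_gt0 hb hn)).
  by field; rewrite !gt_eqF.
Unshelve. all: end_near. Qed.
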